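(* For $b\in\mathbb R$ let $\mathfrak g_b$ be the 4-dimensional Lie algebra with basis $\{f_1,f_2,u,v\}$ whose only nonzero brackets are $[f_1,f_2]=f_2$, $[f_1,u]=-\tfrac12u+bv$, $[f_1,v]=-bu-\tfrac12v$, and let $G_b$ be the simply connected Lie group with Lie algebra $\mathfrak g_b$. Let $\Sigma$ be the set of pairs $(m,n)\in\mathbb Z\times\mathbb Z$ such that $f_{m,n}(x)=x^3-mx^2+nx-1$ has one real root $c$ and two non-real complex conjugate roots $\alpha,\bar\alpha$, and let $\Sigma'=\Sigma\setminus\{(0,0),(1,1),(2,2)\}$. For $(m,n)\in\Sigma'$ write the non-real root with positive imaginary part as $\alpha=|\alpha|e^{i\phi}$ with $\phi\in(0,\pi)$, and for $k\in\mathbb Z$ define $h_k:\Sigma'\to\mathbb R$ by $h_k(m,n)=\frac{\phi+2k\pi}{\log c}$. Then $G_b$ admits a lattice if and only if $b\in\bigcup_{k\in\mathbb Z}\operatorname{Im}(h_k)$, which is a countable subset of $\mathbb R$.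
   Context: A lattice in a Lie group $G$ is a discrete subgroup $\Gamma$ with $\Gamma\backslash G$ compact. For $(m,n)\in\Sigma'$ the real root $c$ satisfies $c>0$ and $c\neq1$, so $h_k$ is well defined. *)

(* Defs.v *)
From HB Require Import structures.
From mathcomp Require Import all_boot all_order all_algebra.
From mathcomp Require Import all_classical all_reals all_analysis.
Set Implicit Arguments. Unset Strict Implicit. Unset Printing Implicit Defensive.
Import Order.TTheory GRing.Theory Num.Theory.
Import numFieldNormedType.Exports.
Local Open Scope classical_set_scope.
Local Open Scope ring_scope.

(* The simply connected Lie group G_b with Lie algebra g_b, realised concretely
   as R ⋉ R^3 (coordinates (t, x, u, v) for exp(t f1) * exp(x f2 + u u + v v)):
   (t1,w1)(t2,w2) = (t1+t2, w1 + exp(t1 ad f1) w2), where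
   exp(t ad f1) = diag(e^t, e^{-t/2} Rot(b t)) on span(f2,u,v). *)
Notation Gb R := (R * R * R * R)%type.

Definition Gmul (R : realType) (b : R) (g h : Gb R) : Gb R :=
  let: (t1, x1, u1, v1) := g in
  let: (t2, x2, u2, v2) := h in
  (t1 + t2,
   x1 + expR t1 * x2,
   u1 + expR (- (t1 / 2)) * (cos (b * t1) * u2 - sin (b * t1) * v2),
   v1 + expR (- (t1 / 2)) * (sin (b * t1) * u2 + cos (b * t1) * v2)).

Definition Gone (R : realType) : Gb R := (0, 0, 0, 0).

Definition is_subgroup (R : realType) (b : R) (Gam : set (Gb R)) : Prop :=
  Gam (Gone R) /\
  (forall g h, Gam g -> Gam h -> Gam (Gmul b g h)) /\
  (forall g, Gam g -> exists h, Gam h /\ Gmul b g h = Gone R /\ Gmul b h g = Gone R).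

Definition is_discrete (R : realType) (Gam : set (Gb R)) : Prop :=
  forall g, Gam g -> exists U, nbhs g U /\ U `&` Gam = [set g].

(* Gam \ G compact, expressed as: G = Gam * K for some compact K *)
Definition cocompact (R : realType) (b : R) (Gam : set (Gb R)) : Prop :=
  exists K : set (Gb R), compact K /\
    forall g, exists gam k, Gam gam /\ K k /\ g = Gmul b gam k.

Definition is_lattice (R : realType) (b : R) (Gam : set (Gb R)) : Prop :=
  is_subgroup b Gam /\ is_discrete Gam /\ cocompact b Gam.

Definition admits_lattice (R : realType) (b : R) : Prop :=
  exists Gam : set (Gb R), is_lattice b Gam.

(* f_{m,n}(x) = x^3 - m x^2 + n x - 1 = (x - c)(x - alpha)(x - conj alpha),
   with c real and alpha = r e^{i phi}, r > 0, phi in (0, pi) (non-real root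
   with positive imaginary part); (x-alpha)(x-conj alpha) = x^2 - 2 r cos phi x + r^2. *)
Definition root_data (R : realType) (m n : int) (c r phi : R) : Prop :=
  0 < r /\ 0 < phi < pi /\
  forall x : R, x ^+ 3 - m%:~R * x ^+ 2 + n%:~R * x - 1
                = (x - c) * (x ^+ 2 - 2 * r * cos phi * x + r ^+ 2).

Definition in_Sigma (R : realType) (m n : int) : Prop :=
  exists c r phi : R, root_data m n c r phi.

Definition in_Sigma' (R : realType) (m n : int) : Prop :=
  @in_Sigma R m n /\ (m, n) <> (0%Z, 0%Z) /\ (m, n) <> (1%Z, 1%Z) /\ (m, n) <> (2%Z, 2%Z).

Definition in_image_h (R : realType) (k : int) (b : R) : Prop :=
  exists (m n : int) (c r phi : R),
    @in_Sigma' R m n /\ root_data m n c r phi /\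
    b = (phi + 2 * k%:~R * pi) / ln c.

(* Main.v *)
(** Let A(s) = exp(s ad f_1), acting on R^3. If Gam is a lattice, its fibre
    L over t = 0 is nontrivial, since otherwise Gam would be abelian; for s in
    the projection P of Gam to the t-axis, A(s) preserves L, so by discreteness
    of L and because A(s) fixes no nonzero vector, P has no small nonzero
    element, and then L is cocompact in R^3. A triple in L of almost minimal
    nonzero determinant shows that tr A(s) is an integer for s in P, and so is
    tr A(-s); these are the m and n of the characteristic polynomial of A(s).
    The roots e^(-s/2 +- i b s) are not real, for otherwise suitable multiples
    s of a period would make tr A(s)^2 - 2 tr A(2s) an integer in (0, 1).
    Conversely, the Z-span of a cyclic vector and its first two images under
    A(log c) is invariant by Cayley-Hamilton, and gives a lattice. *)

Require Import Defs.
From HB Require Import structures.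
From mathcomp Require Import all_boot all_order all_algebra.
From mathcomp Require Import all_classical all_reals all_analysis.
From mathcomp Require Import ring lra zify.
Set Implicit Arguments.
Unset Strict Implicit.
Unset Printing Implicit Defensive.

Import Order.TTheory GRing.Theory Num.Theory.
Import numFieldNormedType.Exports.
Local Open Scope classical_set_scope.
Local Open Scope ring_scope.

(** * Discrete subgroups of R^3 *)

Notation R3 R := (R * R * R)%type.

Definition det3 {R : realType} (p q r : R3 R) : R :=
  p.1.1 * (q.1.2 * r.2 - q.2 * r.1.2) - p.1.2 * (q.1.1 * r.2 - q.2 * r.1.1)
  + p.2 * (q.1.1 * r.1.2 - q.1.2 * r.1.1).

Definition small3 {R : realType} (e : R) (p : R3 R) : Prop :=
  [/\ `|p.1.1| < e, `|p.1.2| < e & `|p.2| < e].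

Section Det3.
Variable R : realType.
Implicit Types (p q r s a : R3 R) (z : int).

Lemma R3_eq p q : p.1.1 = q.1.1 -> p.1.2 = q.1.2 -> p.2 = q.2 -> p = q.
Proof. by case: p => [[? ?] ?]; case: q => [[? ?] ?] /= -> -> ->. Qed.

Lemma R3_mulrz p z :
  [/\ (p *~ z).1.1 = z%:~R * p.1.1, (p *~ z).1.2 = z%:~R * p.1.2
    & (p *~ z).2 = z%:~R * p.2].
Proof.
by split; [rewrite (raddfMz fst) (raddfMz fst)|
           rewrite (raddfMz fst) (raddfMz snd)|rewrite (raddfMz snd)];
   rewrite mulrzl.
Qed.

Lemma det3_cycle p q r : det3 p q r = det3 q r p.
Proof. by rewrite /det3; ring. Qed.

Lemma det3B p q r s : det3 (p - q) r s = det3 p r s - det3 q r s.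
Proof. by rewrite /det3 /=; ring. Qed.

Lemma det3Mz p r s z : det3 (p *~ z) r s = z%:~R * det3 p r s.
Proof. by rewrite /det3; case: (R3_mulrz p z) => -> -> ->; ring. Qed.

Lemma cramer3 p a1 a2 a3 (D := det3 a1 a2 a3) :
  [/\ D * p.1.1 = det3 p a2 a3 * a1.1.1 + det3 p a3 a1 * a2.1.1 + det3 p a1 a2 * a3.1.1,
      D * p.1.2 = det3 p a2 a3 * a1.1.2 + det3 p a3 a1 * a2.1.2 + det3 p a1 a2 * a3.1.2
    & D * p.2 = det3 p a2 a3 * a1.2 + det3 p a3 a1 * a2.2 + det3 p a1 a2 * a3.2].
Proof. by rewrite /D /det3; split; ring. Qed.

(** Multiplicativity of the determinant, with a common denominator [N] cleared so that the
    coordinates with respect to [a1], [a2], [a3] can be integers. *)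
Lemma det3_comb (x1 x2 x3 y1 y2 y3 z1 z2 z3 N : R) a1 a2 a3 p q r :
  N * p.1.1 = x1 * a1.1.1 + x2 * a2.1.1 + x3 * a3.1.1 ->
  N * p.1.2 = x1 * a1.1.2 + x2 * a2.1.2 + x3 * a3.1.2 ->
  N * p.2 = x1 * a1.2 + x2 * a2.2 + x3 * a3.2 ->
  N * q.1.1 = y1 * a1.1.1 + y2 * a2.1.1 + y3 * a3.1.1 ->
  N * q.1.2 = y1 * a1.1.2 + y2 * a2.1.2 + y3 * a3.1.2 ->
  N * q.2 = y1 * a1.2 + y2 * a2.2 + y3 * a3.2 ->
  N * r.1.1 = z1 * a1.1.1 + z2 * a2.1.1 + z3 * a3.1.1 ->
  N * r.1.2 = z1 * a1.1.2 + z2 * a2.1.2 + z3 * a3.1.2 ->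
  N * r.2 = z1 * a1.2 + z2 * a2.2 + z3 * a3.2 ->
  N ^+ 3 * det3 p q r =
  (x1 * (y2 * z3 - y3 * z2) - x2 * (y1 * z3 - y3 * z1) + x3 * (y1 * z2 - y2 * z1))
  * det3 a1 a2 a3.
Proof.
move=> p1 p2 p3 q1 q2 q3 r1 r2 r3.
have -> : N ^+ 3 * det3 p q r =
   N * p.1.1 * (N * q.1.2 * (N * r.2) - N * q.2 * (N * r.1.2))
   - N * p.1.2 * (N * q.1.1 * (N * r.2) - N * q.2 * (N * r.1.1))
   + N * p.2 * (N * q.1.1 * (N * r.1.2) - N * q.1.2 * (N * r.1.1)).
  by rewrite /det3; ring.
by rewrite p1 p2 p3 q1 q2 q3 r1 r2 r3 /det3; ring.
Qed.

End Det3.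

(** * Near-minimal elements of sets of reals *)

Section RealSets.
Variable R : realType.

(** The infimum need not be attained, but being positive it is itself an admissible margin: some
    element lies below twice the infimum. *)
Lemma near_min_exists (S : set R) (e : R) :
  0 < e -> (exists x, S x) -> (forall x, S x -> e <= x) ->
  exists2 x, S x & forall y, S y -> x < 2 * y.
Proof.
move=> e0 S0 Se.
have hlb : has_lbound S by exists e.
have hi : has_inf S by split.
have ie : e <= inf S by apply: lb_le_inf.
have i0 : 0 < inf S by lra.
have [x Sx xlt] := inf_adherent i0 hi.
exists x => // y Sy; have := ge_inf hlb Sy; lra.
Qed.

(* Both [x - floor (x / d) d] and its complement to [d] would have to exceed
   [d / 2]. *)
Lemma near_min_int (S : set R) (d x : R) :
  0 < d -> (forall y, S y -> 0 < y -> d < 2 * y) ->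
  (forall z : int, S (x - z%:~R * d) /\ S (z%:~R * d - x)) ->
  exists z : int, x = z%:~R * d.
Proof.
move=> d0 Sd Sx; set z := Num.floor (x / d).
have /andP[z1 z2] := floor_itv (x / d); rewrite -/z in z1 z2.
have h1 : z%:~R * d <= x by rewrite -ler_pdivlMr.
have h2 : x < (z + 1)%:~R * d by rewrite -ltr_pdivrMr.
have e2 : (z + 1)%:~R * d = z%:~R * d + d by rewrite rmorphD /=; ring.
exists z; apply/eqP/contraT => xz.
have h3 : z%:~R * d < x by rewrite lt_neqAle eq_sym xz.
have [S1 _] := Sx z; have [_ S2] := Sx (z + 1).
have := Sd _ S1; have := Sd _ S2; rewrite e2 in h2 *.
move=> /(_ ltac:(lra)) ? /(_ ltac:(lra)) ?; lra.
Qed.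

End RealSets.

(** * Determinants and traces on discrete subgroups of R^3 *)

Section DiscreteR3.
Variables (R : realType) (L : set (R3 R)) (e : R).
Hypothesis L0 : L 0.
Hypothesis LB : forall p q, L p -> L q -> L (p - q).
Hypothesis e0 : 0 < e.
Hypothesis Le : forall p, L p -> small3 e p -> p = 0.

Lemma subgroup_opp p : L p -> L (- p).
Proof. by move=> Lp; rewrite -sub0r; apply: LB. Qed.

Lemma subgroup_add p q : L p -> L q -> L (p + q).
Proof. by move=> Lp Lq; rewrite -(opprK q); apply: LB => //; apply: subgroup_opp. Qed.

Lemma subgroup_mulrn p (n : nat) : L p -> L (p *+ n).
Proof. by move=> Lp; elim: n => [|n ih]; rewrite ?mulr0n// mulrS; apply: subgroup_add. Qed.

Lemma subgroup_mulrz p (z : int) : L p -> L (p *~ z).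
Proof.
case: z => n Lp; first exact: subgroup_mulrn.
by rewrite NegzE mulrNz; apply: subgroup_opp; exact: subgroup_mulrn.
Qed.

Section Commensurable.
Variables a1 a2 a3 : R3 R.
Hypotheses (La1 : L a1) (La2 : L a2) (La3 : L a3).
Let D := det3 a1 a2 a3.
Hypothesis D0 : D != 0.

(** Rounding down the Cramer coordinates leaves fractional parts in [0, 1), so the remainder lies in
    the parallelepiped spanned by the [ai]. *)
Lemma reduce3 p : L p -> exists z1 z2 z3 : int,
  let q := p - (a1 *~ z1 + a2 *~ z2 + a3 *~ z3) in
  [/\ L q, `|q.1.1| <= `|a1.1.1| + `|a2.1.1| + `|a3.1.1|,
     `|q.1.2| <= `|a1.1.2| + `|a2.1.2| + `|a3.1.2|
     & `|q.2| <= `|a1.2| + `|a2.2| + `|a3.2|].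
Proof.
move=> Lp.
pose fl (x : R) := Num.floor (x / D).
pose z1 := fl (det3 p a2 a3); pose z2 := fl (det3 p a3 a1); pose z3 := fl (det3 p a1 a2).
exists z1, z2, z3 => q.
have Lq : L q.
  by apply: LB => //; do 2?[apply: subgroup_add]; apply: subgroup_mulrz.
have frac x : `|x / D - (fl x)%:~R| <= 1.
  have /andP[] := floor_itv (x / D); rewrite -/(fl x) rmorphD /= => h1 h2.
  rewrite ler_norml; apply/andP; split; lra.
have [m11 m12 m13] := R3_mulrz a1 z1.
have [m21 m22 m23] := R3_mulrz a2 z2.
have [m31 m32 m33] := R3_mulrz a3 z3.
have [c1 c2 c3] := cramer3 p a1 a2 a3; rewrite -/D in c1 c2 c3.
have bnd (y b1 b2 b3 : R) :
   D * y = det3 p a2 a3 * b1 + det3 p a3 a1 * b2 + det3 p a1 a2 * b3 ->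
   `|y - (z1%:~R * b1 + z2%:~R * b2 + z3%:~R * b3)| <= `|b1| + `|b2| + `|b3|.
  move=> cy.
  have -> : y - (z1%:~R * b1 + z2%:~R * b2 + z3%:~R * b3) =
    (det3 p a2 a3 / D - z1%:~R) * b1 + (det3 p a3 a1 / D - z2%:~R) * b2
    + (det3 p a1 a2 / D - z3%:~R) * b3.
    have -> : y = (D * y) / D by field.
    by rewrite cy; field.
  by do 2?[apply: (le_trans (ler_normD _ _)); apply: lerD]; rewrite normrM ler_piMl.
split => //; rewrite /q /=.
- by rewrite m11 m21 m31; apply: bnd.
- by rewrite m12 m22 m32; apply: bnd.
- by rewrite m13 m23 m33; apply: bnd.
Qed.

(* Pigeonhole: among the reductions of the multiples of [p], two fall into
   the same cell of a grid of mesh [e], hence coincide. *)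
Lemma commensurable : exists2 N : nat, (0 < N)%N & forall p, L p ->
  exists z1 z2 z3 : int, p *~ N%:Z = a1 *~ z1 + a2 *~ z2 + a3 *~ z3.
Proof.
pose B1 := `|a1.1.1| + `|a2.1.1| + `|a3.1.1|.
pose B2 := `|a1.1.2| + `|a2.1.2| + `|a3.1.2|.
pose B3 := `|a1.2| + `|a2.2| + `|a3.2|.
pose B := B1 + B2 + B3.
have [B10 B20 B30] : [/\ 0 <= B1, 0 <= B2 & 0 <= B3] by split; rewrite !addr_ge0.
have [B1B B2B B3B] : [/\ B1 <= B, B2 <= B & B3 <= B] by rewrite /B; split; lra.
pose cell (y : R) : nat := Num.truncn ((y + B) / e).
pose M := (Num.truncn ((B + B) / e)).
have cellM y : `|y| <= B -> (cell y < M.+1)%N.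
  rewrite ler_norml => /andP[y1 y2]; rewrite ltnS /cell /M.
  by apply: le_truncn; rewrite ler_pM2r ?invr_gt0// lerD2r.
have cell_eq y y' : `|y| <= B -> `|y'| <= B -> cell y = cell y' -> `|y - y'| < e.
  rewrite !ler_norml => /andP[y1 y2] /andP[y1' y2'].
  have p1 : 0 <= (y + B) / e by rewrite divr_ge0 ?(ltW e0)// -lerBlDr sub0r.
  have p2 : 0 <= (y' + B) / e by rewrite divr_ge0 ?(ltW e0)// -lerBlDr sub0r.
  have /andP[] := truncn_itv p1; have /andP[] := truncn_itv p2.
  rewrite -/(cell y) -/(cell y') => h1 h2 h3 h4 E; rewrite E in h3 h4.
  move: h1 h2 h3 h4; rewrite !ler_pdivlMr// !ltr_pdivrMr// -natr1 mulrDl mul1r.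
  set k := _ * e => *; rewrite ltr_norml; apply/andP; split; lra.
pose T := ('I_M.+1 * 'I_M.+1 * 'I_M.+1)%type.
pose C := #|{: T}|.
(* Pigeonhole gives each [p] its own multiplier [j' - j] between 1 and [C]; the factorial of [C] is
   a multiple of them all. *)
exists (C`!)%N; first exact: fact_gt0.
move=> p Lp.
have red (j : nat) : exists w : R3 R * (int * int * int),
    w.1 = p *+ j - (a1 *~ w.2.1.1 + a2 *~ w.2.1.2 + a3 *~ w.2.2)
    /\ [/\ L w.1, `|w.1.1.1| <= B, `|w.1.1.2| <= B & `|w.1.2| <= B].
  have [z1 [z2 [z3 [Lq h1 h2 h3]]]] := reduce3 (subgroup_mulrn j Lp).
  exists (p *+ j - (a1 *~ z1 + a2 *~ z2 + a3 *~ z3), (z1, z2, z3)) => /=.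
  split=> //; split => //; [exact: le_trans h1 B1B|exact: le_trans h2 B2B|exact: le_trans h3 B3B].
have [w wP] := choice red.
pose f (j : 'I_C.+1) : T :=
  (inord (cell (w j).1.1.1), inord (cell (w j).1.1.2), inord (cell (w j).1.2)).
have : ~~ injectiveb f.
  apply/negP => /injectiveP finj; have := leq_card f finj.
  by rewrite card_ord ltnn.
move=> /injectivePn[j [j' jj' fjj']].
wlog lt : j j' jj' fjj' / (j < j')%N.
  move=> W; case: (ltngtP j j') => [l|l|/val_inj E].
  - exact: (W j j').
  - by apply: (W j' j) => //; rewrite eq_sym.
  - by rewrite E eqxx in jj'.
have [E [Lj j1 j2 j3]] := wP j; have [E' [Lj' j1' j2' j3']] := wP j'.
have weq : (w j).1 = (w j').1.
  apply/eqP; rewrite -subr_eq0; apply/eqP/Le; first exact: LB.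
  move: fjj' => [] /(congr1 val) /= + /(congr1 val) /= + /(congr1 val) /=.
  rewrite !inordK ?cellM// => c1 c2 c3.
  by split => /=; apply: cell_eq.
pose d := (j' - j)%N.
have [z1 [z2 [z3 dp]]] : exists z1 z2 z3 : int, p *+ d = a1 *~ z1 + a2 *~ z2 + a3 *~ z3.
  exists ((w j').2.1.1 - (w j).2.1.1), ((w j').2.1.2 - (w j).2.1.2), ((w j').2.2 - (w j).2.2).
  rewrite mulrnBr ?(ltnW lt)// !mulrzBr.
  move: weq; rewrite E E' => /eqP; rewrite subr_eq addrAC eq_sym subr_eq => /eqP h.
  have -> : p *+ j' = p *+ j + (a1 *~ (w j').2.1.1 + a2 *~ (w j').2.1.2 + a3 *~ (w j').2.2) -
     (a1 *~ (w j).2.1.1 + a2 *~ (w j).2.1.2 + a3 *~ (w j).2.2).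
    by apply/eqP; rewrite eq_sym subr_eq eq_sym; apply/eqP; exact: h.
  rewrite addrAC [p *+ j + _]addrC addrK !opprD.
  by rewrite (AC (3*3) ((1*4)*(2*5)*(3*6))).
have dN : (d %| C`!)%N.
  apply: dvdn_fact; rewrite /d subn_gt0 lt /=.
  by apply: (leq_trans (leq_subr _ _)); rewrite -ltnS.
have /dvdnP[k ->] := dN.
exists (z1 * k%:Z), (z2 * k%:Z), (z3 * k%:Z).
rewrite PoszM mulrC !mulrzA -!mulrzDl.
by congr (_ *~ _); rewrite -dp.
Qed.

(** By [commensurable], [N ^+ 3 * det3 p q r] is an integer multiple of [D], and a nonzero integer
    has absolute value at least 1. *)
Lemma det3_lower_bound : exists2 c : R, 0 < c & forall p q r, L p -> L q -> L r ->
  det3 p q r != 0 -> c <= `|det3 p q r|.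
Proof.
have [N N0 NP] := commensurable.
have N0R : 0 < (N%:R : R) by rewrite ltr0n.
exists (`|D| / N%:R ^+ 3); first by rewrite divr_gt0 ?normr_gt0// exprn_gt0.
have coord p (z1 z2 z3 : int) : p *~ N%:Z = a1 *~ z1 + a2 *~ z2 + a3 *~ z3 ->
  [/\ N%:R * p.1.1 = z1%:~R * a1.1.1 + z2%:~R * a2.1.1 + z3%:~R * a3.1.1,
      N%:R * p.1.2 = z1%:~R * a1.1.2 + z2%:~R * a2.1.2 + z3%:~R * a3.1.2
    & N%:R * p.2 = z1%:~R * a1.2 + z2%:~R * a2.2 + z3%:~R * a3.2].
  move=> h.
  have [p1 p2 p3] := R3_mulrz p N%:Z.
  have [m11 m12 m13] := R3_mulrz a1 z1.
  have [m21 m22 m23] := R3_mulrz a2 z2.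
  have [m31 m32 m33] := R3_mulrz a3 z3.
  rewrite -m11 -m12 -m13 -m21 -m22 -m23 -m31 -m32 -m33.
  by rewrite h /= in p1 p2 p3; rewrite -p1 -p2 -p3.
move=> p q r Lp Lq Lr d0.
have [x1 [x2 [x3 /coord[p1 p2 p3]]]] := NP p Lp.
have [y1 [y2 [y3 /coord[q1 q2 q3]]]] := NP q Lq.
have [z1 [z2 [z3 /coord[r1 r2 r3]]]] := NP r Lr.
have := det3_comb p1 p2 p3 q1 q2 q3 r1 r2 r3.
pose Z := x1 * (y2 * z3 - y3 * z2) - x2 * (y1 * z3 - y3 * z1) + x3 * (y1 * z2 - y2 * z1).
have -> : x1%:~R * (y2%:~R * z3%:~R - y3%:~R * z2%:~R) -
   x2%:~R * (y1%:~R * z3%:~R - y3%:~R * z1%:~R) +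
   x3%:~R * (y1%:~R * z2%:~R - y2%:~R * z1%:~R) = Z%:~R :> R.
  by rewrite /Z; ring.
rewrite -/D => E.
have Z0 : Z != 0.
  apply: contraNneq d0 => Z0; move/eqP: E.
  by rewrite Z0 mul0r mulf_eq0 expf_eq0 /= (gt_eqF N0R).
rewrite ler_pdivrMr ?exprn_gt0//.
have -> : `|det3 p q r| * N%:R ^+ 3 = `|N%:R ^+ 3 * det3 p q r|.
  by rewrite normrM mulrC (ger0_norm (exprn_ge0 _ (ltW N0R))).
rewrite E normrM ler_peMl//.
rewrite -intr_norm -[1]/(1%:~R) ler_int.
by move: Z0; clear; lia.
Qed.

End Commensurable.

Lemma near_min_triple : (exists p q r, [/\ L p, L q, L r & det3 p q r != 0]) ->
  exists a1 a2 a3, [/\ L a1, L a2 & L a3] /\ det3 a1 a2 a3 != 0 /\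
   forall p q r, L p -> L q -> L r -> det3 p q r != 0 ->
     `|det3 a1 a2 a3| < 2 * `|det3 p q r|.
Proof.
move=> [p [q [r [Lp Lq Lr d0]]]].
have [c c0 cP] := det3_lower_bound Lp Lq Lr d0.
have := @near_min_exists R [set y | exists p q r, [/\ L p, L q, L r & det3 p q r != 0] /\ y = `|det3 p q r|] c c0.
case.
- by exists `|det3 p q r|, p, q, r.
- by move=> _ [p' [q' [r' [[? ? ? ?] ->]]]]; apply: cP.
move=> _ [a1 [a2 [a3 [[? ? ? ?] ->]]]] aP.
exists a1, a2, a3; split => //; split => // p' q' r' ? ? ? ?.
by apply: aP; exists p', q', r'.
Qed.

(** Subtracting [z] times [a1] from [p] shifts [det3 p a2 a3] by [z] times the near-minimal
    determinant, so [near_min_int] applies to the values [det3 q a2 a3] with [q] in [L]. *)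
Lemma det3_ratio_int a1 a2 a3 p : L a1 -> L a2 -> L a3 -> L p -> det3 a1 a2 a3 != 0 ->
  (forall p q r, L p -> L q -> L r -> det3 p q r != 0 ->
     `|det3 a1 a2 a3| < 2 * `|det3 p q r|) ->
  exists z : int, det3 p a2 a3 = z%:~R * det3 a1 a2 a3.
Proof.
move=> L1 L2 L3 Lp d0 dmin; set d := det3 a1 a2 a3.
have [z zP] : exists z : int, det3 p a2 a3 = z%:~R * `|d|.
  apply: (@near_min_int R [set y | exists2 q, L q & y = det3 q a2 a3]).
  - by rewrite normr_gt0.
  - move=> y [q Lq ->] y0; rewrite -(gtr0_norm y0); apply: dmin => //.
    by rewrite gt_eqF.
  (* [|d|] is [d] up to a sign, which is absorbed in the integer coefficient of [a1]. *)
  move=> z; have [s ds] : exists s : int, `|d| = s%:~R * d.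
    case: (ltP d 0) => dd; first by exists (-1)%Z; rewrite ltr0_norm//; ring.
    by exists 1%Z; rewrite ger0_norm//; ring.
  split.
    exists (p - a1 *~ (z * s)); first by apply: LB => //; apply: subgroup_mulrz.
    by rewrite det3B det3Mz -/d ds rmorphM /=; ring.
  exists (a1 *~ (z * s) - p); first by apply: LB => //; apply: subgroup_mulrz.
  by rewrite det3B det3Mz -/d ds rmorphM /=; ring.
rewrite zP; case: (ltP d 0) => dd.
  by exists (- z); rewrite ltr0_norm// rmorphN /=; ring.
by exists z; rewrite ger0_norm.
Qed.

(** On a near-minimal triple each of the three determinants is an integer multiple of
    [det3 a1 a2 a3]. Such a triple stands in for a Z-basis of [L]. *)
Lemma trace_preserving_int (A : R3 R -> R3 R) (T : R) :
  (exists p q r, [/\ L p, L q, L r & det3 p q r != 0]) ->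
  (forall p, L p -> L (A p)) ->
  (forall p q r, det3 (A p) q r + det3 (A q) r p + det3 (A r) p q = T * det3 p q r) ->
  exists z : int, T = z%:~R.
Proof.
move=> /near_min_triple[a1 [a2 [a3 [[L1 L2 L3] [d0 dmin]]]]] LA TP.
have [z1 h1] := det3_ratio_int L1 L2 L3 (LA _ L1) d0 dmin.
have c2 : det3 a2 a3 a1 = det3 a1 a2 a3 by rewrite (det3_cycle a1).
have c3 : det3 a3 a1 a2 = det3 a1 a2 a3 by rewrite (det3_cycle a3).
have [z2 h2] : exists z : int, det3 (A a2) a3 a1 = z%:~R * det3 a2 a3 a1.
  by apply: det3_ratio_int; rewrite ?c2 //; apply: LA.
have [z3 h3] : exists z : int, det3 (A a3) a1 a2 = z%:~R * det3 a3 a1 a2.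
  by apply: det3_ratio_int; rewrite ?c3 //; apply: LA.
exists (z1 + z2 + z3).
apply: (mulIf d0); rewrite -TP h1 h2 h3 c2 c3; ring.
Qed.

End DiscreteR3.

(** * Lattices in G_b *)

(** The automorphism exp(s ad f_1) of span(f_2, u, v) that twists the product [Gmul]. *)
Definition act {R : realType} (b s : R) (p : R3 R) : R3 R :=
  (expR s * p.1.1,
   expR (- (s / 2)) * (cos (b * s) * p.1.2 - sin (b * s) * p.2),
   expR (- (s / 2)) * (sin (b * s) * p.1.2 + cos (b * s) * p.2)).

Definition act_trace {R : realType} (b s : R) : R :=
  expR s + 2 * (expR (- (s / 2)) * cos (b * s)).

Lemma expR_eq1 (R : realType) (s : R) : (expR s == 1) = (s == 0).
Proof. by rewrite -expR0 (inj_eq (@expR_inj R)). Qed.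

Section Act.
Variables (R : realType) (b : R).

(** The trace as derivative of the determinant: this characterises it without matrices, in the form
    that [trace_preserving_int] takes. *)
Lemma act_trace_det3 (s : R) p q r :
  det3 (act b s p) q r + det3 (act b s q) r p + det3 (act b s r) p q
  = act_trace b s * det3 p q r.
Proof. by rewrite /det3 /act /act_trace /=; ring. Qed.

Lemma act_sub_small (p : R3 R) (e : R) : 0 < e ->
  exists2 d : R, 0 < d & forall s, `|s| < d -> small3 e (act b s p - p).
Proof.
move=> e0.
have cE : {for 0, continuous (expR : R -> R)} by exact: continuous_expR.
have cH : {for 0, continuous (fun s : R => expR (- (s / 2)))}.
  apply: continuous_comp; last exact: continuous_expR.
  by apply: continuousN; apply: mulrr_continuous.
have cC : {for 0, continuous (fun s : R => cos (b * s))}.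
  by apply: continuous_comp; [exact: mulrl_continuous|exact: continuous_cos].
have cS : {for 0, continuous (fun s : R => sin (b * s))}.
  by apply: continuous_comp; [exact: mulrl_continuous|exact: continuous_sin].
have near0 (f : R -> R) : {for 0, continuous f} -> f 0 = 0 -> \forall s \near (0 : R), `|f s| < e.
  move=> cf f0; move: cf; rewrite /prop_for /continuous_at f0 => /cvgr0_norm_lt.
  exact.
have ck (k : R) : {for 0, continuous (fun _ : R => k)} by exact: cvg_cst.
have h1 : \forall s \near (0 : R), `|expR s * p.1.1 - p.1.1| < e.
  apply: (near0 (fun s => expR s * p.1.1 - p.1.1)).
    by apply: continuousB => //; apply: continuousM.
  by rewrite expR0; ring.
have h2 : \forall s \near (0 : R),
   `|expR (- (s / 2)) * (cos (b * s) * p.1.2 - sin (b * s) * p.2) - p.1.2| < e.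
  apply: (near0 (fun s => expR (- (s / 2)) * (cos (b * s) * p.1.2 - sin (b * s) * p.2) - p.1.2)).
    apply: continuousB => //; apply: continuousM => //.
    by apply: continuousB; apply: continuousM.
  by rewrite mul0r oppr0 expR0 mulr0 cos0 sin0; ring.
have h3 : \forall s \near (0 : R),
   `|expR (- (s / 2)) * (sin (b * s) * p.1.2 + cos (b * s) * p.2) - p.2| < e.
  apply: (near0 (fun s => expR (- (s / 2)) * (sin (b * s) * p.1.2 + cos (b * s) * p.2) - p.2)).
    apply: continuousB => //; apply: continuousM => //.
    by apply: continuousD; apply: continuousM.
  by rewrite mul0r oppr0 expR0 mulr0 cos0 sin0; ring.
have : \forall s \near (0 : R), small3 e (act b s p - p).
  by near=> s; split => /=; near: s.
move=> /nbhs_ballP[d d0 hd]; exists d => // s sd; apply: hd.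
by rewrite /ball /= sub0r normrN.
Unshelve. all: by end_near.
Qed.

(** The action multiplies [x] by e^s and, its other block being a scaled rotation, [u ^+ 2 + v ^+ 2]
    by e^(-s); neither factor is 1. *)
Lemma act_fixed (p : R3 R) (s : R) : act b s p = p -> s != 0 -> p = 0.
Proof.
case: p => [[x u] v] /= [hx hu hv] s0.
have e1 : expR s != 1 by rewrite expR_eq1.
have x0 : x = 0.
  apply/eqP; move: hx => /eqP; rewrite -subr_eq0 -[X in _ - X]mul1r -mulrBl mulf_eq0.
  by rewrite subr_eq0 (negbTE e1).
have : (expR (- s) - 1) * (u ^+ 2 + v ^+ 2) = 0.
  have eE : expR (- s) = expR (- (s / 2)) ^+ 2 by rewrite expr2 -expRD; congr expR; field.
  have : (act b s (x, u, v)).1.2 ^+ 2 + (act b s (x, u, v)).2 ^+ 2 - (u ^+ 2 + v ^+ 2) = 0.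
    by rewrite /= hu hv subrr.
  rewrite /= eE; clear.
  set h := expR _; set C := cos _; set S := sin _.
  have -> : (h * (C * u - S * v)) ^+ 2 + (h * (S * u + C * v)) ^+ 2 =
     h ^+ 2 * (u ^+ 2 + v ^+ 2) * (C ^+ 2 + S ^+ 2) by ring.
  by rewrite /C /S cos2Dsin2 => <-; ring.
move/eqP; rewrite mulf_eq0 subr_eq0 expR_eq1 oppr_eq0 (negbTE s0) /=.
rewrite paddr_eq0 ?sqr_ge0// !sqrf_eq0 => /andP[/eqP -> /eqP ->].
by rewrite x0.
Qed.

End Act.

(** * Uniform bounds over spaced sets *)

Section Spaced.
Variable R : realType.

(** An interval of length [d] holds at most one point of [S], so [-M, M] holds finitely many and the
    largest of their bounds serves. The induction adds one such interval at a time, starting from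
    -M. *)
Lemma spaced_bounded (S : set R) (P : R -> R -> Prop) (d M : R) : 0 < d ->
  (forall s s', S s -> S s' -> `|s - s'| < d -> s = s') ->
  (forall s B B', P s B -> B <= B' -> P s B') ->
  (forall s, S s -> exists B, P s B) ->
  exists B, forall s, S s -> `|s| <= M -> P s B.
Proof.
move=> d0 Sd Pmon PS.
have ind (K : nat) : exists B, forall s, S s -> - M <= s -> s < - M + K%:R * d -> P s B.
  elim: K => [|K [B BP]].
    by exists 0 => s _ h1; rewrite mul0r addr0 => h2; move: (le_lt_trans h1 h2); rewrite ltxx.
  have [[s0 [S0 l0 l0']]|none] := pselect (exists s, [/\ S s, - M + K%:R * d <= s & s < - M + K.+1%:R * d]).
    have [B0 P0] := PS s0 S0.
    exists (Num.max B B0) => s Ss h1 h2; case: (ltP s (- M + K%:R * d)) => h3.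
      by apply: Pmon (BP s Ss h1 h3) _; rewrite le_max lexx.
    have -> : s = s0.
      apply: Sd => //; move: h2 l0'; rewrite -natr1 mulrDl mul1r => h2 l0'.
      by rewrite ltr_norml; apply/andP; split; lra.
    by apply: Pmon P0 _; rewrite le_max lexx orbT.
  exists B => s Ss h1 h2; case: (ltP s (- M + K%:R * d)) => h3; first exact: BP.
  by exfalso; apply: none; exists s.
have [B BP] := ind (Num.truncn ((M + M) / d)).+1.
exists B => s Ss; rewrite ler_norml => /andP[s1 s2]; apply: BP => //.
have := truncnS_gt ((M + M) / d); rewrite ltr_pdivrMr// => h; lra.
Qed.

End Spaced.

(** * Projection and fibre of a lattice *)

Section Lattice.
Variables (R : realType) (b : R) (Gam : set (Gb R)).
Hypothesis G_sub : is_subgroup b Gam.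
Hypothesis G_disc : is_discrete Gam.
Hypothesis G_coc : cocompact b Gam.

Lemma lattice_separated : exists2 e : R, 0 < e & forall t x u v : R, Gam (t, x, u, v) ->
  `|t| < e -> `|x| < e -> `|u| < e -> `|v| < e -> (t, x, u, v) = Gone R.
Proof.
have [G1 _] := G_sub.
have [U [/nbhs_ballP[e /= e0 eU] UG]] := G_disc G1.
exists e => // t x u v Gg ht hx hu hv.
have : (U `&` Gam) (t, x, u, v).
  split => //; apply: eU.
  by do !split => /=; rewrite /ball /= sub0r normrN.
by rewrite UG.
Qed.

Lemma cocompact_bound : exists2 M : R, 0 < M & forall t x u v : R,
  exists t1 x1 u1 v1 t2 x2 u2 v2 : R,
   [/\ Gam (t1, x1, u1, v1), [/\ `|t2| <= M, `|x2| <= M, `|u2| <= M & `|v2| <= M]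
     & (t, x, u, v) = Gmul b (t1, x1, u1, v1) (t2, x2, u2, v2)].
Proof.
have [K [cK KP]] := G_coc.
have [M M0 hM] := pinfty_ex_gt0 (compact_bounded cK).
exists M => // t x u v.
have [[[[t1 x1] u1] v1] [[[[t2 x2] u2] v2] [Gg [Kk E]]]] := KP (t, x, u, v).
exists t1, x1, u1, v1, t2, x2, u2, v2; split => //.
have := hM _ Kk; rewrite /= !prod_normE /= !ge_max => /andP[/andP[/andP[? ?] ?] ?].
by split.
Qed.

Definition proj_t : set R := [set t | exists x u v, Gam (t, x, u, v)].
Definition fiber0 : set (R3 R) := [set p | Gam (0, p.1.1, p.1.2, p.2)].

(** The inverse of (t, q) has vector part -A(-t) q, which the twist A(t) turns into -q; hence (t,
    p)(t, q)^(-1) = (0, p - q). *)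
Lemma fiber0_diff t p q : Gam (t, p.1.1, p.1.2, p.2) -> Gam (t, q.1.1, q.1.2, q.2) ->
  fiber0 (p - q).
Proof.
move: G_sub => [_ [GM GV]] Gp Gq.
have [[[[s x] u] v] [Gh [/= E _]]] := GV _ Gq.
have := GM _ _ Gp Gh => /=; rewrite /fiber0 /=.
move: E => [-> hx hu hv].
by congr (Gam (_, _, _, _)); apply/eqP; rewrite ?(inj_eq (addrI _)) -subr_eq0 opprK addrC ?hx ?hu ?hv.
Qed.

Lemma fiber00 : fiber0 0.
Proof. by move: G_sub => []. Qed.

Lemma fiber0B p q : fiber0 p -> fiber0 q -> fiber0 (p - q).
Proof. exact: fiber0_diff. Qed.

(** For (t, w) in [Gam], the product (t, w)(0, p) = (t, w + A(t) p) lies over the same [t] as (t,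
    w), and [fiber0_diff] subtracts [w]. *)
Lemma fiber0_act t p : proj_t t -> fiber0 p -> fiber0 (act b t p).
Proof.
move: (G_sub) => [_ [GM GV]] [x [u [v Gg]]] Lp.
have := GM _ _ Gg Lp; rewrite /= addr0 => G2.
have := @fiber0_diff t (x + (act b t p).1.1, u + (act b t p).1.2, v + (act b t p).2) (x, u, v).
move=> /(_ G2 Gg); congr fiber0.
by apply: R3_eq => /=; rewrite addrAC subrr add0r.
Qed.

Lemma proj_tN t : proj_t t -> proj_t (- t).
Proof.
move: G_sub => [_ [_ GV]] [x [u [v /GV[[[[s x'] u'] v'] [Gh [/= [E _ _ _] _]]]]]].
by exists x', u', v'; have -> : - t = s by lra.
Qed.

Lemma proj_tD s t : proj_t s -> proj_t t -> proj_t (s + t).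
Proof.
move: G_sub => [_ [GM _]] [x [u [v Gg]]] [x' [u' [v' Gh]]].
by have := GM _ _ Gg Gh => /=; do 3 eexists; eassumption.
Qed.

Lemma proj_t0 : proj_t 0.
Proof. by move: G_sub => [G1 _]; exists 0, 0, 0. Qed.

Lemma proj_tMn t (n : nat) : proj_t t -> proj_t (t *+ n).
Proof.
by move=> Pt; elim: n => [|n ih]; [exact: proj_t0|rewrite mulrS; exact: proj_tD].
Qed.

(** Translates of the compact set must reach t = M + 1, beyond its own bound [M] on the
    t-coordinate. *)
Lemma proj_t_nontrivial : exists2 t, proj_t t & t != 0.
Proof.
have [M M0 /(_ (M + 1) 0 0 0)] := cocompact_bound.
move=> [t1 [x1 [u1 [v1 [t2 [x2 [u2 [v2 [Gg [ht _ _ _] [E _ _ _]]]]]]]]]].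
exists t1; first by exists x1, u1, v1.
move: ht; rewrite ler_norml => /andP[? ?]; apply/eqP; lra.
Qed.

(* If the fibre over 0 were trivial then [Gam] would be abelian, which forces
   [x = kappa (e^t - 1)] on [Gam], so its [x]-coordinate stays bounded when
   [t] does. *)
Lemma fiber0_nontrivial : exists2 p, fiber0 p & p != 0.
Proof.
apply: contrapT => triv.
have trivP p : fiber0 p -> p = 0.
  by move=> Lp; apply/eqP/contraT => p0; exfalso; apply: triv; exists p.
(* The two products of a pair of elements have the same t-coordinate, so they differ by an element
   of the trivial fibre. *)
have comm t x u v t' x' u' v' : Gam (t, x, u, v) -> Gam (t', x', u', v') ->
    x + expR t * x' = x' + expR t' * x.
  move: (G_sub) => [_ [GM _]] Gg Gh.
  have := GM _ _ Gg Gh; have := GM _ _ Gh Gg => /=; rewrite [t' + t]addrC => G1 G2.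
  have /trivP /(congr1 (fun p => p.1.1)) /= := @fiber0_diff (t + t') (_, _, _) (_, _, _) G2 G1.
  by move/eqP; rewrite subr_eq0 => /eqP.
have [t0 [x0 [u0 [v0 Gg0]]] t00] := proj_t_nontrivial.
have e1 : expR t0 - 1 != 0 by rewrite subr_eq0 expR_eq1.
pose k := x0 / (expR t0 - 1).
have [M M0 MP] := cocompact_bound.
(* One more than the largest x-coordinate compatible with [|t1| <= M]. The target point is taken
   over t = 0, so that t1 = -t2 obeys this bound. *)
pose X := `|k| * (expR M + 1) + expR M * M + 1.
have [t1 [x1 [u1 [v1 [t2 [x2 [u2 [v2 [Gg [ht hx _ _] [Et Ex _ _]]]]]]]]]] := MP 0 X 0 0.
have x1E : x1 = k * (expR t1 - 1).
  have := comm _ _ _ _ _ _ _ _ Gg0 Gg => h.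
  rewrite /k mulrAC; apply: (mulIf e1); rewrite divfK//.
  by move: h; set E0 := expR t0; set E1 := expR t1 => h; lra.
have tM : expR t1 <= expR M.
  by rewrite ler_expR; move: ht; rewrite ler_norml => /andP[? ?]; lra.
have b1 : x1 <= `|k| * (expR M + 1).
  rewrite x1E; apply: (le_trans (ler_norm _)); rewrite normrM ler_wpM2l//.
  rewrite ler_norml; have := expR_gt0 t1; have := expR_gt0 M => ? ?.
  by apply/andP; split; lra.
have b2 : expR t1 * x2 <= expR M * M.
  apply: (le_trans (ler_norm _)); rewrite normrM ler_pM//.
  by rewrite gtr0_norm ?expR_gt0.
rewrite /X in Ex; lra.
Qed.

(* For [s] small [act b s p - p] is a small element of the fibre, hence zero. *)
Lemma proj_t_separated : exists2 d : R, 0 < d & forall s, proj_t s -> `|s| < d -> s = 0.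
Proof.
have [p Lp p0] := fiber0_nontrivial.
have [e e0 eP] := lattice_separated.
have [d d0 dP] := act_sub_small b p e0.
exists d => // s Ps sd; apply/eqP/contraT => s0.
have [h1 h2 h3] := dP s sd.
have := fiber0B (fiber0_act Ps Lp) Lp => /eP; rewrite normr0 => /(_ e0 h1 h2 h3) [k1 k2 k3].
move: p0; rewrite (@act_fixed _ b p s) ?eqxx//.
by apply: R3_eq; apply/eqP; rewrite -subr_eq0; apply/eqP.
Qed.

(** Write (0, p) = (t1, w1)(t2, w2), so that |t1| <= M. By spacing, [proj_t] has finitely many
    points in [-M, M], so some (t1, w3) in [Gam] is bounded uniformly. Then q = w1 - w3 is in the
    fibre, and p - q = w3 + A(t1) w2 is bounded. *)
Lemma fiber0_cocompact : exists2 M : R, 0 < M & forall p, exists q,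
  [/\ fiber0 q, `|p.1.1 - q.1.1| <= M, `|p.1.2 - q.1.2| <= M & `|p.2 - q.2| <= M].
Proof.
have [d d0 dP] := proj_t_separated.
have [M M0 MP] := cocompact_bound.
pose P (s B : R) := exists x u v, [/\ Gam (s, x, u, v), `|x| <= B, `|u| <= B & `|v| <= B].
have [|||B BP] := @spaced_bounded R proj_t P d M d0.
- move=> s s' Ps Ps' l; apply/eqP; rewrite -subr_eq0; apply/eqP/dP => //.
  by apply: proj_tD => //; apply: proj_tN.
- move=> s B B' [x [u [v [? h1 h2 h3]]]] BB; exists x, u, v.
  by split => //; [exact: le_trans h1 BB|exact: le_trans h2 BB|exact: le_trans h3 BB].
- move=> s [x [u [v Gg]]]; exists (`|x| + `|u| + `|v|), x, u, v.
  have := normr_ge0 x; have := normr_ge0 u; have := normr_ge0 v => *.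
  by split => //; lra.
have EM : 1 <= expR M by apply: le_trans (expR_ge1Dx M); lra.
exists (`|B| + 2 * expR M * M); first by have := normr_ge0 B; nra.
move=> [[x u] v].
have [t1 [x1 [u1 [v1 [t2 [x2 [u2 [v2 [Gg [ht hx hu hv] [Et -> -> ->]]]]]]]]]] := MP 0 x u v.
have tM : `|t1| <= M by have -> : t1 = - t2; [lra|rewrite normrN].
have Pt : proj_t t1 by exists x1, u1, v1.
have [x3 [u3 [v3 [Gg3 hx3 hu3 hv3]]]] := BP t1 Pt tM.
exists ((x1, u1, v1) - (x3, u3, v3)); split => /=.
- exact: (@fiber0_diff t1 (_, _, _) (_, _, _)).
- rewrite (_ : x1 + _ - _ = x3 + expR t1 * x2); last by ring.
  apply: (le_trans (ler_normD _ _)); apply: lerD; first exact: le_trans hx3 (ler_norm _).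
  rewrite normrM (gtr0_norm (expR_gt0 _)).
  have : expR t1 <= expR M by rewrite ler_expR; apply: le_trans tM; apply: ler_norm.
  have := normr_ge0 x2; have := expR_gt0 t1; nra.
all: have hM : expR (- (t1 / 2)) <= expR M
  by rewrite ler_expR; move: tM; rewrite ler_norml => /andP[? ?]; lra.
all: have rot (c s y z : R) : `|c| <= 1 -> `|s| <= 1 -> `|y| <= M -> `|z| <= M ->
  `|expR (- (t1 / 2)) * (c * y + s * z)| <= 2 * expR M * M
 by move=> c1 s1 y1 z1; rewrite normrM (gtr0_norm (expR_gt0 _));
    have -> : 2 * expR M * M = expR M * (M + M); [ring|];
    apply: ler_pM => //; apply: (le_trans (ler_normD _ _)); apply: lerD;
    rewrite normrM; apply: le_trans (ler_piMl _ _) _.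
all: have cb : `|cos (b * t1)| <= 1 by rewrite ler_norml cos_geN1 cos_le1.
all: have sb : `|sin (b * t1)| <= 1 by rewrite ler_norml sin_geN1 sin_le1.
- set w := expR _ * _.
  rewrite (_ : u1 + _ - _ = u3 + w); last by ring.
  apply: (le_trans (ler_normD _ _)); apply: lerD; first exact: le_trans hu3 (ler_norm _).
  by rewrite /w -[- (sin _ * _)]mulNr; apply: rot => //; rewrite normrN.
- set w := expR _ * _.
  rewrite (_ : v1 + _ - _ = v3 + w); last by ring.
  apply: (le_trans (ler_normD _ _)); apply: lerD; first exact: le_trans hv3 (ler_norm _).
  exact: rot.
Qed.

(** Fibre points within [M] of 10M times the unit vectors form a matrix with diagonal entries at
    least 9M and the others at most [M] in size. The diagonal term of the expansion is at least 720
    M^3, the other two together at most 24 M^3. *)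
Lemma fiber0_spans : exists p q r, [/\ fiber0 p, fiber0 q, fiber0 r & det3 p q r != 0].
Proof.
have [M M0 MP] := fiber0_cocompact.
have [p [Lp p1 p2 p3]] := MP (10 * M, 0, 0).
have [q [Lq q1 q2 q3]] := MP (0, 10 * M, 0).
have [r [Lr r1 r2 r3]] := MP (0, 0, 10 * M).
exists p, q, r; split => //; rewrite gt_eqF//.
move: p q r {Lp Lq Lr} p1 p2 p3 q1 q2 q3 r1 r2 r3.
move=> [[a1 a2] a3] [[b1 b2] b3] [[c1 c2] c3]; rewrite /det3 /= !ler_norml.
do 9 move=> /andP[? ?].
have prod (x y B C : R) : - B <= x -> x <= B -> - C <= y -> y <= C -> - (B * C) <= x * y <= B * C.
  move=> *; rewrite -ler_norml normrM ler_pM// ler_norml; apply/andP; split; lra.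
have m1 : 80 * M ^+ 2 <= b2 * c3 - b3 * c2.
  have /andP[? ?] : - (M * M) <= b3 * c2 <= M * M by apply: prod; lra.
  have : (9 * M) * (9 * M) <= b2 * c3 by apply: ler_pM; lra.
  by rewrite expr2; lra.
have /andP[? ?] : - (12 * M ^+ 2) <= b1 * c3 - b3 * c1 <= 12 * M ^+ 2.
  have /andP[? ?] : - (M * M) <= b3 * c1 <= M * M by apply: prod; lra.
  have /andP[? ?] : - (M * (11 * M)) <= b1 * c3 <= M * (11 * M) by apply: prod; lra.
  by rewrite expr2; apply/andP; split; lra.
have /andP[? ?] : - (12 * M ^+ 2) <= b1 * c2 - b2 * c1 <= 12 * M ^+ 2.
  have /andP[? ?] : - (M * M) <= b1 * c2 <= M * M by apply: prod; lra.
  have /andP[? ?] : - (11 * M * M) <= b2 * c1 <= (11 * M) * M by apply: prod; lra.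
  by rewrite expr2; apply/andP; split; lra.
have M2 : 0 < M ^+ 2 by rewrite exprn_gt0.
have M3 : 0 < M * M ^+ 2 by rewrite mulr_gt0.
have : (9 * M) * (80 * M ^+ 2) <= a1 * (b2 * c3 - b3 * c2) by apply: ler_pM; lra.
have /andP[] : - (M * (12 * M ^+ 2)) <= a2 * (b1 * c3 - b3 * c1) <= M * (12 * M ^+ 2).
  by apply: prod; lra.
have /andP[] : - (M * (12 * M ^+ 2)) <= a3 * (b1 * c2 - b2 * c1) <= M * (12 * M ^+ 2).
  by apply: prod; lra.
lra.
Qed.

Lemma act_trace_int s : proj_t s -> exists z : int, act_trace b s = z%:~R.
Proof.
move=> Ps; have [e e0 eP] := lattice_separated.
apply: (@trace_preserving_int R fiber0 e _ _ e0 _ (act b s)).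
- exact: fiber00.
- exact: fiber0B.
- move=> p Lp [h1 h2 h3]; have := eP _ _ _ _ Lp; rewrite normr0 => /(_ e0 h1 h2 h3)[k1 k2 k3].
  exact: R3_eq.
- exact: fiber0_spans.
- by move=> p; apply: fiber0_act.
- exact: act_trace_det3.
Qed.

End Lattice.

(** * The polynomials f_{m,n} *)

Section Angles.
Variable R : realType.
Implicit Types (x : R) (k : int).

Lemma cos_sin_addz2pi x k :
  cos (x + 2 * k%:~R * pi) = cos x /\ sin (x + 2 * k%:~R * pi) = sin x.
Proof.
have pos (y : R) (n : nat) : cos (y + 2 * n%:R * pi) = cos y /\ sin (y + 2 * n%:R * pi) = sin y.
  elim: n => [|n [ih1 ih2]]; first by rewrite mulr0 mul0r addr0.
  have -> : y + 2 * n.+1%:R * pi = (y + 2 * n%:R * pi) + pi *+ 2.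
    by rewrite -natr1 mulr2n; ring.
  by rewrite cosD2pi sinD2pi.
case: k => n; first exact: pos.
have [h1 h2] := pos (x + 2 * (Negz n)%:~R * pi) n.+1.
have e : x + 2 * (Negz n)%:~R * pi + 2 * n.+1%:R * pi = x.
  by rewrite NegzE rmorphN /= -pmulrn; ring.
by rewrite e in h1 h2; rewrite -h1 -h2.
Qed.

(** Reduce [x] modulo 2 pi into [0, 2 pi); a positive sine rules out 0 and [pi, 2 pi). *)
Lemma sin_gt0_angle x : 0 < sin x -> exists (k : int) (phi : R),
  0 < phi < pi /\ x = phi + 2 * k%:~R * pi.
Proof.
move=> sx; have p0 := pi_gt0 R.
pose k := Num.floor (x / (2 * pi)).
have p20 : 0 < 2 * (pi : R) by lra.
have /andP[] := floor_itv (x / (2 * pi)); rewrite -/k.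
rewrite ler_pdivlMr// ltr_pdivrMr// rmorphD /= => h1 h2.
have xE : x = (x - 2 * k%:~R * pi) + 2 * k%:~R * pi by ring.
exists k, (x - 2 * k%:~R * pi); split => //.
set phi := x - _ in xE *.
have sphi : 0 < sin phi by rewrite -(cos_sin_addz2pi phi k).2 -xE.
have phi0 : 0 <= phi by rewrite /phi; lra.
have phi2 : phi < 2 * pi by rewrite /phi; lra.
apply/andP; split.
  by rewrite lt_neqAle phi0 andbT; apply/negP => /eqP h; move: sphi; rewrite -h sin0 ltxx.
rewrite ltNge; apply/negP => h.
have : 0 <= sin (phi - pi) by apply: sin_ge0_pi; apply/andP; split; lra.
have -> : sin (phi - pi) = - sin phi.
  by have -> : sin phi = sin (phi - pi + pi); [rewrite subrK|rewrite sinDpi opprK].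
lra.
Qed.

End Angles.

(** * Vieta relations, uniqueness of the roots and countability *)

Section RootData.
Variable R : realType.
Implicit Types (m n : int) (c r phi : R).

(** Vieta's relations. Both sides are monic cubics, so the values at 0, 1 and -1 determine the
    remaining coefficients. *)
Lemma root_dataP m n c r phi : 0 < r -> 0 < phi < pi ->
  root_data m n c r phi <->
  [/\ c * r ^+ 2 = 1, m%:~R = c + 2 * r * cos phi & n%:~R = 2 * r * cos phi * c + r ^+ 2].
Proof.
move=> r0 phi0; split; last first.
  move=> [h1 h2 h3]; split => //; split => // x.
  by rewrite h2 h3 -h1; ring.
move=> [_ [_ h]].
have h0 := h 0; have h1 := h 1; have h2 := h (-1).
have e : c * r ^+ 2 = 1.
  by move: h0; rewrite expr0n /= !mulr0 !expr0n /= => ?; lra.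
move: h1 h2; rewrite expr1n sqrrN expr1n !mulr1 !mulrN1 => h1 h2.
have e3 : (-1) ^+ 3 = -1 :> R by ring.
rewrite e3 in h2; split => //; lra.
Qed.

(** The quadratic is |x - alpha|^2 with alpha not real; hence [c] is the only real root of the
    cubic. *)
Lemma conj_quad_gt0 r phi (x : R) : 0 < r -> 0 < phi < pi ->
  0 < x ^+ 2 - 2 * r * cos phi * x + r ^+ 2.
Proof.
move=> r0 /sin_gt0_pi s0.
have -> : x ^+ 2 - 2 * r * cos phi * x + r ^+ 2 =
  (x - r * cos phi) ^+ 2 + (r * sin phi) ^+ 2.
  by rewrite !exprMn sin2cos2; ring.
by rewrite ltr_wpDl ?sqr_ge0// exprn_gt0// mulr_gt0.
Qed.

(** The excluded pairs are those with log c = 0. If c = 1 then r = 1 and m = n = 1 + 2 cos phi lies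
    strictly between -1 and 3; conversely m = n makes 1 a real root, which must be [c]. *)
Lemma root_data_eq1 m n c r phi : root_data m n c r phi ->
  c = 1 <-> [\/ (m, n) = (0%Z, 0%Z), (m, n) = (1%Z, 1%Z) | (m, n) = (2%Z, 2%Z)].
Proof.
move=> rd; have [r0 [phi0 h]] := rd.
have [e em en] := (root_dataP m n c r0 phi0).1 rd.
split.
  move=> c1; rewrite c1 mul1r in e.
  have r1 : r = 1 by apply/eqP; rewrite -(@eqrXn2 _ 2) ?ler01 ?(ltW r0)// expr1n e.
  rewrite c1 r1 expr1n !mulr1 in em en.
  have mn : m = n by apply: (@intr_inj R); rewrite em en addrC.
  have s2 : 0 < sin phi ^+ 2 by rewrite exprn_gt0// sin_gt0_pi.
  have cs := cos2Dsin2 phi.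
  have c1' : cos phi < 1 by nra.
  have c2' : -1 < cos phi by nra.
  have : ((-1)%:~R : R) < m%:~R by rewrite em; lra.
  have : (m%:~R : R) < 3%:~R by rewrite em; lra.
  rewrite !ltr_int -mn => h1 h2.
  have : [\/ m = 0%Z, m = 1%Z | m = 2%Z].
    have : m = 0%Z \/ m = 1%Z \/ m = 2%Z by lia.
    by move=> [|[]] ?; [constructor 1|constructor 2|constructor 3].
  by case=> ->; [constructor 1|constructor 2|constructor 3].
move=> E; have mn : m = n by case: E => -[-> ->].
have := h 1; rewrite expr1n mn => h1.
have q0 := conj_quad_gt0 1 r0 phi0.
rewrite expr1n in h1 q0.
have /eqP : (1 - c) * (1 - 2 * r * cos phi * 1 + r ^+ 2) = 0 by rewrite -h1; ring.
by rewrite mulf_eq0 (gt_eqF q0) orbF subr_eq0 => /eqP.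
Qed.

(** [c] is the only real root, c r^2 = 1 then gives [r], the coefficient [m] gives cos phi, and cos
    is injective on [0, pi]. *)
Lemma root_data_unique m n c r phi c' r' phi' :
  root_data m n c r phi -> root_data m n c' r' phi' -> c = c' /\ phi = phi'.
Proof.
move=> rd rd'; have [r0 [phi0 h]] := rd; have [r0' [phi0' h']] := rd'.
have [e em en] := (root_dataP m n c r0 phi0).1 rd.
have [e' em' en'] := (root_dataP m n c' r0' phi0').1 rd'.
have cc : c = c'.
  have := h' c; rewrite h subrr mul0r => /esym/eqP.
  by rewrite mulf_eq0 (gt_eqF (conj_quad_gt0 c r0' phi0')) orbF subr_eq0 => /eqP.
split=> //; rewrite -cc in e' em'.
have c0 : c != 0 by apply: contra_eq_neq e => ->; rewrite mul0r eq_sym oner_neq0.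
have rr : r = r'.
  apply/eqP; rewrite -(@eqrXn2 _ 2) ?(ltW r0) ?(ltW r0')//.
  by apply/eqP/(mulfI c0); rewrite e e'.
apply: cos_inj.
- by move: phi0 => /andP[? ?]; rewrite in_itv /= !ltW.
- by move: phi0' => /andP[? ?]; rewrite in_itv /= !ltW.
apply: (mulfI (lt0r_neq0 r0)); rewrite [in RHS]rr.
rewrite em in em'; lra.
Qed.

(** The set is covered by pieces indexed by the triples (m, n, k), and by [root_data_unique] each
    piece has at most one point. *)
Lemma countable_image_h : countable [set b : R | exists k : int, in_image_h k b].
Proof.
pose F (w : int * int * int) : set R := [set b | exists c r phi,
  root_data w.1.1 w.1.2 c r phi /\ b = (phi + 2 * w.2%:~R * pi) / ln c].
apply: (@sub_countable _ _ _ (\bigcup_(w in [set: int * int * int]) F w)).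
  apply: subset_card_le => b [k [m [n [c [r [phi [_ [rd ->]]]]]]]].
  by exists (m, n, k) => //; exists c, r, phi.
apply: bigcup_countable => // w _.
have [[x Fx]|Fn] := pselect (exists x, F w x); last first.
  suff -> : F w = set0 by [].
  by apply/seteqP; split => // x Fx; apply: Fn; exists x.
suff -> : F w = [set x] by apply: finite_set_countable.
apply/seteqP; split => [y|y ->//].
case: Fx => c [r [phi [rd ->]]] [c' [r' [phi' [rd' ->]]]].
by have [-> ->] := root_data_unique rd rd'.
Qed.

End RootData.

(** * From a lattice to a root *)

Section LatticeToRoot.
Variables (R : realType) (b : R) (Gam : set (Gb R)).
Hypothesis G_lat : is_lattice b Gam.

Let P := proj_t Gam.

Let PN s : P s -> P (- s).
Proof. by case: G_lat => [? [? ?]]; apply: (@proj_tN R b). Qed.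

Let Ptr s : P s -> exists z : int, act_trace b s = z%:~R.
Proof. by case: G_lat => [? [? ?]]; apply: act_trace_int. Qed.

(* With [sin (b t) = 0] and [y = e^(s/2)] for a very negative even multiple [s]
   of [t], the integer [tr(s)^2 - 2 tr(2s)] equals [4 y - y^4], in (0, 1). *)
Lemma lattice_sin_neq0 t : P t -> t != 0 -> sin (b * t) != 0.
Proof.
wlog tneg : t / t < 0.
  move=> W Pt t0; have [tn|] := ltP t 0; first exact: W.
  move=> tp; have := W (- t); rewrite mulrN sinN !oppr_eq0; apply => //.
    by rewrite oppr_lt0 lt_neqAle eq_sym t0.
  exact: PN.
move=> Pt t0; apply/eqP => sin0bt.
have sinn (j : nat) : sin (b * t *+ j) = 0.
  by elim: j => [|j ih]; rewrite ?mulr0n ?sin0// mulrS sinD sin0bt ih; ring.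
(* Then s / 2 = j t < -4, so 1 / y = e^(-s/2) >= 1 - s/2 > 4 and 4 y < 1. *)
pose j := (Num.truncn (4 / - t)).+1.
have jt : 4 < - t * j%:R.
  by have := truncnS_gt (4 / - t); rewrite -/j ltr_pdivrMr ?oppr_gt0// mulrC.
pose s := (t *+ j) *+ 2.
(* Doubling the multiple makes the cosine 1, where sin = 0 alone would also allow -1. *)
have cos1 (i : nat) : cos (b * ((t *+ i) *+ 2)) = 1.
  have -> : b * ((t *+ i) *+ 2) = (b * t *+ i) *+ 2 by rewrite -!mulrnAr.
  rewrite cos_mulr2n cos2sin2 sinn; ring.
have Pmul (i : nat) u : P u -> P (u *+ i).
  by case: G_lat => [? [? ?]]; apply: (@proj_tMn R b).
have [z1 h1] : exists z : int, act_trace b s = z%:~R by apply: Ptr; apply: (Pmul); apply: (Pmul).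
have [z2 h2] : exists z : int, act_trace b (s *+ 2) = z%:~R by apply: Ptr; apply: (Pmul); apply: (Pmul); apply: (Pmul).
pose y := expR (s / 2).
have y0 : 0 < y by exact: expR_gt0.
have y1 : y < 1 / 4.
  have -> : y = (expR (- (t *+ j)))^-1.
    by rewrite -expRN opprK /y /s; congr expR; rewrite -mulr_natr; field.
  rewrite div1r ltf_pV2 ?posrE ?expR_gt0//.
  have := expR_ge1Dx (- (t *+ j)); rewrite -mulr_natr.
  by move=> ?; lra.
have e1 : expR s = y ^+ 2 by rewrite expr2 -expRD; congr expR; field.
have e2 : expR (- (s / 2)) = y^-1 by rewrite expRN.
have e3 : expR (s *+ 2) = y ^+ 4.
  by rewrite -[4%N]/(2 * 2)%N exprM -e1 mulr2n expRD expr2.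
have e4 : expR (- (s *+ 2 / 2)) = y ^- 2.
  by rewrite expRN -e1; congr (expR _)^-1; rewrite -mulr_natr; field.
move: h1 h2; rewrite /act_trace e1 e2 e3 e4.
have -> : cos (b * s) = 1 by exact: cos1.
have -> : cos (b * (s *+ 2)) = 1 by rewrite /s -[t *+ j *+ 2]mulrnA; exact: cos1.
rewrite !mulr1 => h1 h2.
have hz : (z1 ^+ 2 - 2 * z2)%:~R = 4 * y - y ^+ 4.
  by rewrite rmorphB rmorphXn rmorphM /= -h1 -h2; field; rewrite gt_eqF.
have y4 : y ^+ 4 < 4 * y.
  have : y ^+ 3 < 1 by rewrite exprn_ilt1 ?ltW//; lra.
  by rewrite exprS => ?; nra.
have y40 : 0 < y ^+ 4 by exact: exprn_gt0.
have : (0%:~R : R) < (z1 ^+ 2 - 2 * z2)%:~R by rewrite hz; lra.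
have : (z1 ^+ 2 - 2 * z2)%:~R < (1%:~R : R) by rewrite hz; lra.
rewrite !ltr_int; lia.
Qed.

(** Take c = e^t and alpha = e^(-t/2 + i b t), the eigenvalues of A(t). Their product with conj
    alpha is 1, so the second symmetric function is the trace of the inverse: m = tr A(t) and n = tr
    A(-t). *)
Lemma lattice_in_image_h : exists k : int, in_image_h k b.
Proof.
have [t Pt [t0 st]] : exists2 t, P t & t != 0 /\ 0 < sin (b * t).
  have [t Pt t0] : exists2 t, P t & t != 0.
    by case: G_lat => [? [? ?]]; apply: (@proj_t_nontrivial R b).
  (* Passing from [t] to [- t] if necessary makes alpha the root in the upper half plane. *)
  have := lattice_sin_neq0 Pt t0; rewrite neq_lt => /orP[s0|s0].
    exists (- t); first exact: PN.
    by rewrite mulrN sinN oppr_eq0 oppr_gt0.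
  by exists t.
have [m hm] := Ptr Pt; have [n hn] := Ptr (PN Pt).
have [k [phi [phi0 btE]]] := sin_gt0_angle st.
have cosE : cos (b * t) = cos phi by rewrite btE; exact: (cos_sin_addz2pi phi k).1.
pose c := expR t; pose r := expR (- (t / 2)).
have r0 : 0 < r by exact: expR_gt0.
have rd : root_data m n c r phi.
  apply/root_dataP => //.
  have cr : c * r ^+ 2 = 1.
    by rewrite expr2 /c /r -!expRD -[RHS]expR0; congr expR; field.
  split => //.
    by rewrite -hm /act_trace cosE /c /r; ring.
  rewrite -hn /act_trace mulrN cosN cosE.
  have -> : expR (- t) = r ^+ 2 by rewrite expr2 /r -expRD; congr expR; field.
  have -> : expR (- (- t / 2)) = c * r by rewrite /c /r -expRD; congr expR; field.
  by ring.
have cn1 : c <> 1 by move=> /eqP; rewrite /c expR_eq1 (negbTE t0).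
exists k, m, n, c, r, phi; split; last first.
  by split => //; rewrite /c expRK -btE mulfK.
split; first by exists c, r, phi.
have exc := (root_data_eq1 rd).2.
by split=> [E|]; [|split=> E]; apply: cn1; apply: exc; rewrite E;
   [constructor 1|constructor 2|constructor 3].
Qed.

End LatticeToRoot.

(** * Construction of a lattice *)

Definition pack {R : realType} (t : R) (p : R3 R) : Gb R := (t, p.1.1, p.1.2, p.2).

Section ActTheory.
Variables (R : realType) (b : R).

Lemma Gmul_pack (t s : R) p q :
  Gmul b (pack t p) (pack s q) = pack (t + s) (p + act b t q).
Proof. by []. Qed.

Lemma act0 p : act b 0 p = p.
Proof.
by apply: R3_eq => /=; rewrite ?mulr0 ?mul0r ?oppr0 expR0 ?cos0 ?sin0; ring.
Qed.

Lemma actB (t : R) p q : act b t (p - q) = act b t p - act b t q.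
Proof. by apply: R3_eq => /=; ring. Qed.

Lemma actD (s t : R) p : act b (s + t) p = act b s (act b t p).
Proof.
have e : expR (- ((s + t) / 2)) = expR (- (s / 2)) * expR (- (t / 2)).
  by rewrite -expRD; congr expR; field.
by apply: R3_eq => /=; rewrite ?expRD ?e ?mulrDr ?cosD ?sinD; ring.
Qed.

Lemma actK (t : R) p : act b t (act b (- t) p) = p.
Proof. by rewrite -actD subrr act0. Qed.

Lemma actNK (t : R) p : act b (- t) (act b t p) = p.
Proof. by rewrite -actD addNr act0. Qed.

End ActTheory.

Lemma normr_det3_le (R : realType) (e : R) (p q r : R3 R) : small3 e p ->
  `|det3 p q r| <= e * (`|q.1.2 * r.2 - q.2 * r.1.2| + `|q.1.1 * r.2 - q.2 * r.1.1|
    + `|q.1.1 * r.1.2 - q.1.2 * r.1.1|).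
Proof.
move=> [h1 h2 h3]; rewrite /det3 ![e * _]mulrDr.
apply: (le_trans (ler_normD _ _)); apply: lerD; last by rewrite normrM ler_wpM2r// ltW.
by apply: (le_trans (ler_normB _ _)); apply: lerD; rewrite normrM ler_wpM2r// ltW.
Qed.

(** * The lattice spanned by the orbit of a cyclic vector *)

Section RootToLattice.
Variables (R : realType) (m n : int) (c r phi b : R) (k : int).
Hypothesis rd : root_data m n c r phi.
Hypothesis c1 : c != 1.
Hypothesis bE : b = (phi + 2 * k%:~R * pi) / ln c.

Let al := r * cos phi.
Let be := r * sin phi.
Let t0 := ln c.

Let r0 : 0 < r. Proof. by case: rd. Qed.
Let phi0 : 0 < phi < pi. Proof. by case: rd => _ []. Qed.
Let coefs := (root_dataP m n c r0 phi0).1 rd.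

Let cr2 : c * r ^+ 2 = 1. Proof. by case: coefs. Qed.

Let c0 : 0 < c.
Proof. by rewrite -(@pmulr_lgt0 _ (r ^+ 2)) ?exprn_gt0// cr2 ltr01. Qed.

Let t00 : t0 != 0.
Proof. by rewrite /t0 ln_eq0// (negbTE c1). Qed.

Let rho : al ^+ 2 + be ^+ 2 = r ^+ 2.
Proof. by rewrite /al /be !exprMn -mulrDr cos2Dsin2 mulr1. Qed.

Let mE : m%:~R = c + 2 * al.
Proof. by case: coefs => _ -> _; rewrite /al mulrA. Qed.

Let nE : n%:~R = 2 * al * c + (al ^+ 2 + be ^+ 2).
Proof. by case: coefs => _ _ ->; rewrite rho /al !mulrA. Qed.

Let be0 : 0 < be.
Proof. by rewrite mulr_gt0// sin_gt0_pi. Qed.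

(** Here b log c = phi + 2 k pi, and c r^2 = 1 gives e^(-t0/2) = r. So A(log c) multiplies the first
    coordinate by [c] and the complex number u + i v by alpha. *)
Let act_t0 p : act b t0 p = (c * p.1.1, al * p.1.2 - be * p.2, be * p.1.2 + al * p.2).
Proof.
have bt : b * t0 = phi + 2 * k%:~R * pi by rewrite bE divfK.
have er : expR (- (t0 / 2)) = r.
  apply/eqP; rewrite -(@eqrXn2 _ 2) ?expR_ge0 ?(ltW r0)//.
  rewrite expr2 -expRD (_ : _ + _ = - t0); last by field.
  rewrite expRN lnK ?posrE//; apply/eqP/(mulfI (lt0r_neq0 c0)).
  by rewrite cr2 divff ?gt_eqF.
have [cE sE] := cos_sin_addz2pi phi k.
rewrite /act bt cE sE er lnK ?posrE//.
by apply: R3_eq => //=; rewrite /al /be; ring.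
Qed.

(* [w0, w1, w2] is the orbit of a cyclic vector: the coordinates of
   [a0 w0 + a1 w1 + a2 w2] are the values at [c] and at [alpha = al + i be]
   of the polynomial [a0 + a1 X + a2 X^2]. *)
Let w0 : R3 R := (1, 1, 0).
Let w1 : R3 R := (c, al, be).
Let w2 : R3 R := (c ^+ 2, al ^+ 2 - be ^+ 2, 2 * al * be).
Let comb (a0 a1 a2 : int) : R3 R := w0 *~ a0 + w1 *~ a1 + w2 *~ a2.

Let combE a0 a1 a2 : comb a0 a1 a2 =
  (a0%:~R + a1%:~R * c + a2%:~R * c ^+ 2,
   a0%:~R + a1%:~R * al + a2%:~R * (al ^+ 2 - be ^+ 2),
   a1%:~R * be + a2%:~R * (2 * al * be)).
Proof.
have [h1 h2 h3] := R3_mulrz w0 a0.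
have [k1 k2 k3] := R3_mulrz w1 a1.
have [l1 l2 l3] := R3_mulrz w2 a2.
by apply: R3_eq; rewrite /= ?h1 ?h2 ?h3 ?k1 ?k2 ?k3 ?l1 ?l2 ?l3 /=; ring.
Qed.

Let combB a0 a1 a2 a0' a1' a2' :
  comb a0 a1 a2 - comb a0' a1' a2' = comb (a0 - a0') (a1 - a1') (a2 - a2').
Proof. by rewrite !combE; apply: R3_eq => /=; rewrite !rmorphB /=; ring. Qed.

(* Cayley-Hamilton *)
Let act_comb a0 a1 a2 :
  act b t0 (comb a0 a1 a2) = comb a2 (a0 - n * a2) (a1 + m * a2).
Proof.
have cr : c * (al ^+ 2 + be ^+ 2) = 1 by rewrite rho.
rewrite act_t0 !combE; apply: R3_eq => /=;
  rewrite !rmorphB !rmorphD !rmorphM /= mE nE.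
(* Writing the constant term 1 of the cubic as c |alpha|^2 turns the goal into a polynomial identity
   in [c], [al], [be]. *)
- by rewrite -[X in _ = X + _ + _]mulr1 -[X in _ = _ * X + _ + _]cr; ring.
- by rewrite -[X in _ = X + _ + _]mulr1 -[X in _ = _ * X + _ + _]cr; ring.
- by ring.
Qed.

(** Up to a constant factor this is the Vandermonde determinant of c, alpha and conj alpha. *)
Let D0 : det3 w0 w1 w2 != 0.
Proof.
have -> : det3 w0 w1 w2 = be * ((c - al) ^+ 2 + be ^+ 2) by rewrite /det3 /=; ring.
by rewrite mulf_neq0 ?gt_eqF// ltr_wpDl ?sqr_ge0 ?exprn_gt0.
Qed.

Let inL (p : R3 R) : Prop := exists a0 a1 a2, p = comb a0 a1 a2.

Let inLB p q : inL p -> inL q -> inL (p - q).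
Proof.
move=> [a0 [a1 [a2 ->]]] [a0' [a1' [a2' ->]]]; rewrite combB; do 3 eexists; reflexivity.
Qed.

Let inL0 : inL 0.
Proof. by exists 0, 0, 0; rewrite combE; apply: R3_eq => /=; ring. Qed.

Let inLD p q : inL p -> inL q -> inL (p + q).
Proof.
by move=> hp hq; rewrite -(opprK q); apply: inLB => //; rewrite -sub0r; apply: inLB.
Qed.

Let inL_act (j : int) p : inL p -> inL (act b (j%:~R * t0) p).
Proof.
have pos (i : nat) q : inL q -> inL (act b (i%:R * t0) q).
  elim: i q => [|i ih] q Lq; first by rewrite mul0r act0.
  rewrite -natr1 mulrDl mul1r actD; apply: ih.
  by case: Lq => a0 [a1 [a2 ->]]; rewrite act_comb; do 3 eexists; reflexivity.
have neg1 q : inL q -> inL (act b (- t0) q).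
  case=> a0 [a1 [a2 ->]].
  (* The companion map of [act_comb] has an integral inverse, because the constant term of the cubic
     is a unit; these are its coefficients. *)
  exists (n * a0 + a1), (- m * a0 + a2), a0.
  have -> : comb a0 a1 a2 = act b t0 (comb (n * a0 + a1) (- m * a0 + a2) a0).
    by rewrite act_comb; congr comb; ring.
  by rewrite actNK.
have neg (i : nat) q : inL q -> inL (act b (- (i%:R * t0)) q).
  elim: i q => [|i ih] q Lq; first by rewrite mul0r oppr0 act0.
  by rewrite -natr1 mulrDl mul1r opprD actD; apply: ih; apply: neg1.
case: j => i Lp; first exact: pos.
by rewrite NegzE rmorphN /= mulNr; apply: neg.
Qed.

Definition root_lattice : set (Gb R) :=
  [set g | exists (j : int) (a0 a1 a2 : int), g = pack (j%:~R * t0) (comb a0 a1 a2)].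

Let root_latticeP (j : int) p : inL p -> root_lattice (pack (j%:~R * t0) p).
Proof. by move=> [a0 [a1 [a2 ->]]]; exists j, a0, a1, a2. Qed.

Lemma root_lattice_subgroup : is_subgroup b root_lattice.
Proof.
have oneE : Gone R = pack 0 0 by [].
split; first by rewrite oneE -(mul0r t0); apply: (root_latticeP 0).
split.
  move=> _ _ [j [a0 [a1 [a2 ->]]]] [j' [a0' [a1' [a2' ->]]]].
  rewrite Gmul_pack -mulrDl -rmorphD /=; apply: root_latticeP.
  by apply: inLD; [exists a0, a1, a2|apply: inL_act; exists a0', a1', a2'].
move=> _ [j [a0 [a1 [a2 ->]]]].
set p := comb _ _ _; have Lp : inL p by exists a0, a1, a2.
exists (pack ((- j)%:~R * t0) (0 - act b ((- j)%:~R * t0) p)); split.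
  by apply: root_latticeP; apply: inLB => //; apply: inL_act.
rewrite !Gmul_pack rmorphN /= mulNr subrr addNr oneE actB actK.
have a00 s : act b s 0 = 0 by rewrite -[X in act b s X](subrr 0) actB subrr.
by rewrite a00 !sub0r subrr addNr.
Qed.

(** By Cramer's rule a coefficient times [det3 w0 w1 w2] is a determinant with the combination as
    one row. For a small combination it is smaller than |det3 w0 w1 w2|, so the integer coefficient
    is 0. *)
Let comb_small : exists2 e : R, 0 < e & forall a0 a1 a2,
  small3 e (comb a0 a1 a2) -> [/\ a0 = 0, a1 = 0 & a2 = 0].
Proof.
pose N (q s : R3 R) := `|q.1.2 * s.2 - q.2 * s.1.2| + `|q.1.1 * s.2 - q.2 * s.1.1|
    + `|q.1.1 * s.1.2 - q.1.2 * s.1.1|.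
have N0 q s : 0 <= N q s by rewrite !addr_ge0.
(* The extra 1 makes every cofactor sum strictly smaller than [C]. *)
pose C := N w1 w2 + N w2 w0 + N w0 w1 + 1.
have [n1 n2 n3] := And3 (N0 w1 w2) (N0 w2 w0) (N0 w0 w1).
have C0 : 0 < C by rewrite /C; lra.
pose e := `|det3 w0 w1 w2| / C.
have e0 : 0 < e by rewrite divr_gt0 ?normr_gt0.
have eC : e * C = `|det3 w0 w1 w2| by rewrite divfK ?gt_eqF.
exists e => // a0 a1 a2 sm.
have key (a : int) q s : N q s < C -> det3 (comb a0 a1 a2) q s = a%:~R * det3 w0 w1 w2 -> a = 0.
  move=> NC E; have := normr_det3_le q s sm; rewrite -/(N q s) E normrM => h.
  have : `|a%:~R| * `|det3 w0 w1 w2| < `|det3 w0 w1 w2|.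
    by apply: (le_lt_trans h); rewrite -eC ltr_pM2l.
  rewrite -[ltRHS]mul1r ltr_pM2r ?normr_gt0// -intr_norm -[1]/(1%:~R) ltr_int.
  by clear; lia.
split.
- apply: (key _ w1 w2); first by rewrite /C; lra.
  by rewrite combE /det3 /=; ring.
- apply: (key _ w2 w0); first by rewrite /C; lra.
  by rewrite combE /det3 /=; ring.
- apply: (key _ w0 w1); first by rewrite /C; lra.
  by rewrite combE /det3 /=; ring.
Qed.

Lemma root_lattice_discrete : is_discrete root_lattice.
Proof.
move=> _ [j [a0 [a1 [a2 ->]]]].
have [e e0 eP] := comb_small.
(* Closeness below [|t0|] forces equal [j], and closeness below [e] then forces equal
   coefficients. *)
pose d := Num.min e `|t0|.
have d0 : 0 < d by rewrite lt_min e0 normr_gt0.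
set g := pack _ _.
exists (ball g d); split; first exact: nbhsx_ballx.
apply/seteqP; split; last first.
  by move=> _ ->; split; [exact: ballxx|exists j, a0, a1, a2].
move=> h [/= [[[bt bx] bu] bv] [j' [a0' [a1' [a2' E]]]]]; rewrite E in bt bx bu bv *.
move: bt bx bu bv; rewrite /ball /= => bt bx bu bv.
have jj : j = j'.
  have : `|(j - j')%:~R * t0| < `|t0|.
    by rewrite rmorphB /= mulrBl; apply: (lt_le_trans bt); rewrite ge_min lexx orbT.
  rewrite normrM -[ltRHS]mul1r ltr_pM2r ?normr_gt0// -intr_norm -[1]/(1%:~R) ltr_int.
  by clear; lia.
have de : d <= e by rewrite ge_min lexx.
have [h1 h2 h3] : [/\ a0 - a0' = 0, a1 - a1' = 0 & a2 - a2' = 0].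
  by apply: eP; rewrite -combB; split; apply: lt_le_trans de.
by rewrite /g jj -(subr0_eq h1) -(subr0_eq h2) -(subr0_eq h3).
Qed.

Lemma root_lattice_cocompact : cocompact b root_lattice.
Proof.
pose B := (`|w0.1.1| + `|w1.1.1| + `|w2.1.1|) + (`|w0.1.2| + `|w1.1.2| + `|w2.1.2|)
  + (`|w0.2| + `|w1.2| + `|w2.2|).
pose J := `[- B, B]%classic.
exists (`[- `|t0|, `|t0|]%classic `*` J `*` J `*` J); split.
  by do 3 ?apply: compact_setX; apply: segment_compact.
move=> [[[t x] u] v].
pose j := Num.floor (t / t0).
(* The vector is pulled back by A(-j t0) before it is reduced, because the compact factor stands on
   the right and is twisted by A(j t0). *)
pose p := act b (- (j%:~R * t0)) (x, u, v).
(* [reduce3] is applied to the whole of R^3 as the subgroup. *)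
have [z0 [z1 [z2 [_ h1 h2 h3]]]] := @reduce3 R setT I (fun _ _ _ _ => I) w0 w1 w2 I I I D0 p I.
exists (pack (j%:~R * t0) (act b (j%:~R * t0) (comb z0 z1 z2))), (pack (t - j%:~R * t0) (p - comb z0 z1 z2)).
split; first by apply: root_latticeP; apply: inL_act; exists z0, z1, z2.
split; last first.
  rewrite Gmul_pack actB actK.
  rewrite [t - _]addrC addrA subrr add0r.
  by rewrite [(x, u, v) - _]addrC addrA subrr add0r.
have [n1 n2 n3] : [/\ 0 <= `|w0.1.1| + `|w1.1.1| + `|w2.1.1|,
  0 <= `|w0.1.2| + `|w1.1.2| + `|w2.1.2| & 0 <= `|w0.2| + `|w1.2| + `|w2.2|].
  by split; rewrite !addr_ge0.
have /andP[f1 f2] := floor_itv (t / t0); rewrite -/j in f1 f2.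
have ft : `|t - j%:~R * t0| <= `|t0|.
  have -> : t - j%:~R * t0 = (t / t0 - j%:~R) * t0 by field.
  rewrite normrM ler_piMl// ler_norml.
  by rewrite rmorphD /= in f2; apply/andP; split; lra.
split; [split; [split|]|]; rewrite ?/J /= in_itv /= -ler_norml //.
- by apply: (le_trans h1); rewrite /B; lra.
- by apply: (le_trans h2); rewrite /B; lra.
- by apply: (le_trans h3); rewrite /B; lra.
Qed.

End RootToLattice.

Theorem theorem3p9 (R : realType) :
  (forall b : R, admits_lattice b <-> exists k : int, in_image_h k b) /\
  countable [set b : R | exists k : int, in_image_h k b].
Proof.
split; last exact: countable_image_h.
move=> b; split; first by move=> [Gam /lattice_in_image_h].
move=> [k [m [n [c [r [phi [[_ [mn0 [mn1 mn2]]] [rd bE]]]]]]]].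
have c1 : c != 1 by apply/eqP => /(root_data_eq1 rd)[/mn0|/mn1|/mn2].
exists (root_lattice c r phi); split; first exact: root_lattice_subgroup rd c1 bE.
split; first exact: root_lattice_discrete rd c1.
exact: root_lattice_cocompact rd c1 bE.
Qed.
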